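(* For any graph $G$ it holds that $x(G) \ge 1/b(G)$. If $G$ is edge-transitive, then equality holds.
   Context: All graphs are finite, undirected, loopless, and have at least one edge. For $W \subseteq V(G)$, $\delta(W)$ denotes the set of edges of $G$ with exactly one end in $W$; a cut of $G$ is any edge set of the form $\delta(W)$. For positive integers $n,k$, an $n/k$-cover of $G$ is an $n$-tuple $(X_1,\dots,X_n)$ of cuts in $G$ (repetitions allowed) such that every edge of $G$ lies in at least $k$ of them. The fractional cut-covering number is $x(G) = \inf\{ n/k \mid \text{there exists an } n/k\text{-cover of } G\}$. $\mathrm{MAXCUT}(G)$ is the number of edges in a largest cut of $G$, and $b(G) = \mathrm{MAXCUT}(G)/|E(G)|$ is the bipartite density of $G$. *)

(* Defs.v *)
From HB Require Import structures.
From mathcomp Require Import all_boot all_order all_algebra all_fingroup.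
From mathcomp Require Import boolp classical_sets reals.

Set Implicit Arguments.
Unset Strict Implicit.
Unset Printing Implicit Defensive.

Import Order.TTheory GRing.Theory Num.Theory.
Local Open Scope ring_scope.

(* Finite, undirected, loopless graphs with at least one edge. Edges form a   *)
(* type of their own, so parallel edges are allowed; a simple graph is the    *)
(* case where [ends] is injective.                                            *)
Record graph := Graph {
  vertex : finType;
  edge : finType;
  ends : edge -> {set vertex};
  card_ends : forall e, #|ends e| = 2%N;
  has_edge : (0 < #|edge|)%N }.

Section Graph.
Variable G : graph.

Definition delta (W : {set vertex G}) : {set edge G} :=
  [set e | #|ends e :&: W| == 1%N].

Definition is_cut (X : {set edge G}) : bool :=
  [exists W : {set vertex G}, X == delta W].

Definition is_cover (n k : nat) (X : n.-tuple {set edge G}) : Prop :=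
  (forall i : 'I_n, is_cut (tnth X i)) /\
  (forall e : edge G, (k <= #|[set i : 'I_n | e \in tnth X i]|)%N).

Definition maxcut : nat := (\max_(X : {set edge G} | is_cut X) #|X|)%N.

(* With parallel edges an automorphism acts on vertices and on edges; on a    *)
(* simple graph the edge permutation [t] is determined by [s].                *)
Definition is_automorphism (s : {perm vertex G}) (t : {perm edge G}) : Prop :=
  forall e : edge G, ends (t e) = [set s v | v in ends e].

Definition edge_transitive : Prop :=
  forall e f : edge G, exists (s : {perm vertex G}) (t : {perm edge G}),
    is_automorphism s t /\ t e = f.

Variable R : realType.

Definition cover_ratios : set R :=
  [set r : R | exists n k : nat,
     [/\ (0 < n)%N, (0 < k)%N,
         exists X : n.-tuple {set edge G}, is_cover k X
       & r = n%:R / k%:R] ]%classic.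

Definition frac_cut_covering : R := inf cover_ratios.

Definition bipartite_density : R := maxcut%:R / #|edge G|%:R.

End Graph.

(* Main.v *)
Require Import Defs.
From mathcomp Require Import all_boot all_order all_algebra all_fingroup.
From mathcomp Require Import boolp classical_sets reals.
(* Last, so that finite-set lemmas hide their namesakes on classical sets. *)
From mathcomp Require Import fintype finset.

(** Double counting the pairs (edge, member of the cover containing it) in an
    [n/k]-cover gives [k |E| <= n MAXCUT], because every edge is counted at
    least [k] times and every cut has at most MAXCUT edges; this is
    [n/k >= 1/b] ([cover_ratio_ge]).  An infimum over the reals inherits the
    bound only if there is a cover at all, and the family of all cuts is one
    ([cover_ratios_nonempty]).

    For an edge-transitive graph, fix a maximum cut [M] and take the family of
    its preimages under all automorphisms.  Each member is again a maximum cut,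
    so one of the two inequalities is an equality; composing with an automorphism
    that carries [e] to [f] shows that [e] and [f] are covered equally often, so
    the other one is an equality as well.  This cover has ratio exactly [1/b]
    ([edge_transitive_ratio]). *)

Set Implicit Arguments.
Unset Strict Implicit.
Unset Printing Implicit Defensive.

Import Order.TTheory GRing.Theory Num.Theory.
Local Open Scope ring_scope.

Lemma sum_card_mem (I E : finType) (A : {set I}) (F : I -> {set E}) :
  (\sum_(e : E) #|[set i in A | e \in F i]| = \sum_(i in A) #|F i|)%N.
Proof.
under eq_bigr => e _ do rewrite -sum1_card.
under [RHS]eq_bigr => i _ do rewrite -sum1_card.
rewrite (exchange_big_dep (mem A)) /=; last by move=> e i _; rewrite inE; case/andP.
by apply: eq_bigr => i iA; apply: eq_bigl => e; rewrite inE iA.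
Qed.

Section Covers.
Variables (R : realType) (G : graph).
Implicit Types (W : {set vertex G}) (X : {set edge G}) (e f : edge G).

Lemma exists_edge : exists e : edge G, true.
Proof. by case/card_gt0P: (has_edge G) => e _; exists e. Qed.

Lemma delta_is_cut W : is_cut (delta W).
Proof. by apply/existsP; exists W. Qed.

(** The singleton of one end of [e] separates it from the other end. *)
Lemma edge_in_cut e : exists W, e \in delta W.
Proof.
have [v ve] : exists v, v \in ends e by apply/card_gt0P; rewrite card_ends.
by exists [set v]; rewrite inE (setIidPr _) ?cards1 ?sub1set.
Qed.

Lemma card_cut_le_maxcut X : is_cut X -> (#|X| <= maxcut G)%N.
Proof. by move=> cX; rewrite /maxcut (bigD1 X) //= leq_maxl. Qed.

Lemma maxcut_gt0 : (0 < maxcut G)%N.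
Proof.
have [e _] := exists_edge; have [W eW] := edge_in_cut e.
apply: leq_trans (card_cut_le_maxcut (delta_is_cut W)).
by apply/card_gt0P; exists e.
Qed.

Lemma exists_maxcut : exists W, #|delta W| = maxcut G.
Proof.
have [X cX mX] := eq_bigmax_cond (fun X : {set edge G} => #|X|)
  (introT card_gt0P (ex_intro _ (delta set0) (delta_is_cut set0))).
by case/existsP: cX => W /eqP eX; exists W; rewrite -eX -mX.
Qed.

(** Covers are easier to build as families over an arbitrary finite index set
    than as tuples: the two constructions below are indexed by vertex sets and by
    pairs of permutations. *)
Lemma family_cover_ratio (I : finType) (A : {set I}) (F : I -> {set edge G})
    (k : nat) :
  (0 < k)%N -> {in A, forall i, is_cut (F i)} ->
  (forall e, (k <= #|[set i in A | e \in F i]|)%N) ->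
  @cover_ratios G R (#|A|%:R / k%:R).
Proof.
move=> k0 cF kF; exists #|A|, k; split=> //.
  have [e _] := exists_edge.
  apply: leq_trans k0 (leq_trans (kF e) (subset_leq_card _)).
  by apply/subsetP=> i; rewrite inE; case/andP.
exists [tuple F (enum_val i) | i < #|A|]; split=> [i|e].
  by rewrite tnth_mktuple; apply/cF/enum_valP.
apply: leq_trans (kF e) _.
rewrite -(card_imset _ (@enum_val_inj _ (mem A))); apply/subset_leq_card/subsetP.
move=> i; rewrite inE => /andP[iA eFi]; apply/imsetP.
exists (enum_rank_in iA i); last by rewrite enum_rankK_in.
by rewrite inE tnth_mktuple enum_rankK_in.
Qed.

Lemma cover_ratios_nonempty : (@cover_ratios G R !=set0)%classic.
Proof.
exists (#|[set: {set vertex G}]|%:R / 1%:R).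
apply: (@family_cover_ratio _ _ (@delta G)) => // [W _|e]; first exact: delta_is_cut.
by have [W eW] := edge_in_cut e; apply/card_gt0P; exists W; rewrite inE in_setT.
Qed.

Lemma inv_bipartite_density :
  1 / bipartite_density G R = #|edge G|%:R / (maxcut G)%:R.
Proof. by rewrite /bipartite_density div1r invf_div. Qed.

Lemma cover_ratio_ge (r : R) :
  @cover_ratios G R r -> 1 / bipartite_density G R <= r.
Proof.
case=> n [k [n0 k0 [X [cX kX]] ->]]; rewrite inv_bipartite_density.
rewrite ler_pdivrMr ?ltr0n ?maxcut_gt0 // mulrAC ler_pdivlMr ?ltr0n //.
rewrite -!natrM ler_nat.
have count : (\sum_e #|[set i | e \in tnth X i]| = \sum_(i < n) #|tnth X i|)%N.
  rewrite (eq_bigl (mem [set: 'I_n])) => [|i]; last by rewrite !inE.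
  by rewrite -sum_card_mem; apply: eq_bigr => e _; apply: eq_card => i; rewrite !inE.
apply: (@leq_trans (\sum_e #|[set i | e \in tnth X i]|)%N).
  by rewrite -sum_nat_const; apply: leq_sum => e _; apply: kX.
rewrite count -[n in (_ <= n * _)%N]card_ord -sum_nat_const.
by apply: leq_sum => i _; apply/card_cut_le_maxcut/cX.
Qed.

Lemma frac_cut_covering_ge :
  1 / bipartite_density G R <= frac_cut_covering G R.
Proof.
by apply: lb_le_inf => [|r]; [exact: cover_ratios_nonempty|exact: cover_ratio_ge].
Qed.

Definition automorphisms : {set {perm vertex G} * {perm edge G}} :=
  [set p : {perm vertex G} * {perm edge G} |
    [forall e, ends (p.2 e) == [set p.1 v | v in ends e]]].

Lemma automorphismsP p :
  reflect (is_automorphism p.1 p.2) (p \in automorphisms).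
Proof. by rewrite inE; apply: (iffP forallP) => h e; apply/eqP/h. Qed.

Lemma automorphismsM p q :
  p \in automorphisms -> q \in automorphisms -> (p * q)%g \in automorphisms.
Proof.
move=> /automorphismsP ap /automorphismsP aq; apply/automorphismsP=> e /=.
rewrite permM aq ap -imset_comp; apply: eq_imset => v /=.
by rewrite permM.
Qed.

(** Preimages, unlike images, need no inverse permutation: [p.1] carries the ends
    of [e] to those of [p.2 e], so [W] splits the latter exactly when its preimage
    splits the former. *)
Lemma preim_delta p W : p \in automorphisms ->
  p.2 @^-1: delta W = delta (p.1 @^-1: W).
Proof.
move=> /automorphismsP ap; apply/setP=> e; rewrite !inE ap.
rewrite -(card_imset (_ :&: (p.1 @^-1: W)) (@perm_inj _ p.1)).
congr (#|pred_of_set _| == _); apply/setP=> v; rewrite !inE.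
apply/andP/imsetP => [[/imsetP[u ue ->] uW]|[u]].
  by exists u; rewrite // !inE ue.
by rewrite !inE => /andP[ue uW] ->; rewrite imset_f.
Qed.

(** Products of permutations apply the left factor first, so multiplying on the
    left by an automorphism that carries [e] to [f] injects the automorphisms
    that send [f] into [X] into those that send [e] into [X]. *)
Lemma edge_transitive_count X e f : edge_transitive G ->
  (#|[set p in automorphisms | f \in p.2 @^-1: X]|
     <= #|[set p in automorphisms | e \in p.2 @^-1: X]|)%N.
Proof.
move=> /(_ e f) [s [t [ast tef]]].
rewrite -(card_imset _ (mulgI (s, t))).
apply/subset_leq_card/subsetP=> _ /imsetP[p pX ->].
move: pX; rewrite in_set => /andP[ap]; rewrite inE => fX.
rewrite in_set automorphismsM //=; last exact/automorphismsP.
by rewrite inE permM tef.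
Qed.

Lemma edge_transitive_ratio : edge_transitive G ->
  @cover_ratios G R (1 / bipartite_density G R).
Proof.
move=> Gtr; have [W mW] := exists_maxcut; have [e0 _] := exists_edge.
pose F (p : {perm vertex G} * {perm edge G}) := p.2 @^-1: delta W.
pose k := #|[set p in automorphisms | e0 \in F p]|.
have keq e : #|[set p in automorphisms | e \in F p]| = k.
  by apply/eqP; rewrite eqn_leq !edge_transitive_count.
have count : (#|edge G| * k = #|automorphisms| * maxcut G)%N.
  rewrite -!sum_nat_const -(eq_bigr _ (fun e _ => keq e)) sum_card_mem.
  apply: eq_bigr => p _; rewrite -mW -(card_imset _ (@perm_inj _ p.2)).
  congr #|pred_of_set _|; apply/setP=> e; rewrite -[e](permKV p.2).
  by rewrite mem_imset ?inE //; exact: perm_inj.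
have A0 : (0 < #|automorphisms|)%N.
  apply/card_gt0P; exists 1%g; apply/automorphismsP=> e /=.
  by rewrite perm1 (eq_imset _ (@perm1 _)) imset_id.
have k0 : (0 < k)%N.
  by have := maxcut_gt0; rewrite -(ltn_pmul2l A0) muln0 -count muln_gt0 => /andP[].
rewrite inv_bipartite_density.
rewrite (_ : _ / _ = #|automorphisms|%:R / k%:R); last first.
  apply/eqP; rewrite eqr_div ?pnatr_eq0 -?lt0n ?maxcut_gt0 //.
  by rewrite -!natrM count.
apply: (@family_cover_ratio _ _ F) => // [p ap|e]; last by rewrite keq.
by rewrite /F preim_delta // delta_is_cut.
Qed.

End Covers.

Theorem lemma2p1 (R : realType) (G : graph) :
  frac_cut_covering G R >= 1 / bipartite_density G R /\
  (edge_transitive G -> frac_cut_covering G R = 1 / bipartite_density G R).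
Proof.
split=> [|Gtr]; first exact: frac_cut_covering_ge.
apply/eqP; rewrite eq_le frac_cut_covering_ge andbT.
apply: ge_inf; last exact: edge_transitive_ratio.
by exists (1 / bipartite_density G R) => r; apply: cover_ratio_ge.
Qed.
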